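(* Let $k$ be a perfect field of positive characteristic and let $R$ be a reduced $k$-algebra essentially of finite type. Then $$\tau\big(R, \mathscr{D}^{(2)}(R), \mathfrak a^s \mathfrak b^t\big) \subseteq \tau(R, \mathfrak a^s)\, \tau(R, \mathfrak b^t)$$ for all ideals $\mathfrak a, \mathfrak b \subseteq R$ and all real numbers $s,t \geq 0$, provided that neither $\mathfrak a$ nor $\mathfrak b$ consists of zero-divisors (that is, each contains a regular element).
   Context: Let $p=\operatorname{char} k>0$. For a commutative ring $R$ of characteristic $p$, $F^e_*R$ denotes $R$ viewed as an $R$-module via the $e$-th iterate of Frobenius: its elements are written $F^e_*r$ and $s\cdot F^e_*r = F^e_*(s^{p^e}r)$. All rings are Noetherian and $F$-finite ($F^e_*R$ is a finitely generated $R$-module); this is automatic here. A Cartier algebra on $R$ is $\mathscr C=\bigoplus_{e\ge 0}\mathscr C_e$ with $\mathscr C_e\subseteq \operatorname{Hom}_R(F^e_*R,R)$, $\mathscr C_0=R$, such that each $\mathscr C_e$ is closed under addition, under $\varphi\mapsto r\varphi$ and under $\varphi \mapsto \varphi(F^e_*(r\,\cdot\,))$ for $r\in R$, and such that $\varphi\in\mathscr C_e,\psi\in\mathscr C_d$ imply $\varphi\circ F^e_*\psi\in\mathscr C_{e+d}$. The full Cartier algebra is $\mathscr C^R=\bigoplus_{e\ge0}\operatorname{Hom}_R(F^e_*R,R)$. For $R$ reduced, a Cartier algebra $\mathscr C$, ideals $\mathfrak a_i$ and real $t_i\ge0$, the test ideal $\tau(R,\mathscr C,\prod_i\mathfrak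 a_i^{t_i})$ is the smallest ideal $J\subseteq R$ containing a regular element such that for all $e\geq 0$, all $\varphi\in\mathscr C_e$ and all $x\in\prod_i\mathfrak a_i^{\lceil t_i(p^e-1)\rceil}$ one has $\varphi(F^e_*(xJ))\subseteq J$ (the products $\prod_i \mathfrak a_i^{t_i}$ are purely formal). One writes $\tau(R,\prod_i\mathfrak a_i^{t_i})=\tau(R,\mathscr C^R,\prod_i\mathfrak a_i^{t_i})$. Let $\mu\colon R\otimes_kR\to R$, $x\otimes y\mapsto xy$. The second diagonal Cartier algebra $\mathscr D^{(2)}(R)=\bigoplus_e \mathscr D^{(2)}_e(R)$ is the Cartier algebra on $R$ whose degree $e$ part consists of those $\varphi\in\operatorname{Hom}_R(F^e_*R,R)$ for which there exists $\widehat\varphi\in\operatorname{Hom}_{R\otimes_kR}(F^e_*(R\otimes_kR),R\otimes_kR)$ with $\mu\circ\widehat\varphi=\varphi\circ F^e_*\mu$. *)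

(* Defs.v *)
(* Mathematical Components, with classical logic and classical sets from
   MathComp-Analysis. *)
From HB Require Import structures.
From mathcomp Require Import all_boot all_order all_algebra.
From mathcomp Require Import boolp classical_sets reals.

Set Implicit Arguments.
Unset Strict Implicit.
Unset Printing Implicit Defensive.

Import GRing.Theory.
Local Open Scope quotient_scope.
Local Open Scope classical_set_scope.
Local Open Scope ring_scope.

Section Rings.
Context {R : comPzRingType}.

Definition reduced : Prop := forall (x : R) (n : nat), x ^+ n = 0 -> x = 0.

Definition is_ideal (I : set R) : Prop :=
  [/\ I 0, forall x y, I x -> I y -> I (x + y) & forall r x, I x -> I (r * x)].

(* [GRing.lreg c] says that multiplication by [c] is injective. *)
Definition has_regular (I : set R) : Prop := exists2 c, I c & GRing.lreg c.

Definition ideal_mul (I J : set R) : set R :=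
  [set x | exists2 s : seq (R * R),
     forall u, u \in s -> I u.1 /\ J u.2 & x = \sum_(u <- s) u.1 * u.2].

Definition ideal_exp (I : set R) (n : nat) : set R :=
  iter n (ideal_mul I) setT.

End Rings.
Arguments reduced : clear implicits.

(* A commutative algebra over [k] is a commutative ring with a ring morphism
   from [k]; unlike [comAlgType k], this includes the zero ring. *)
Section FiniteType.
Context {k : fieldType}.

Definition finite_type (B : comPzRingType) (iB : {rmorphism k -> B}) : Prop :=
  exists y : seq B, forall P : set B,
    (forall a, P (iB a)) -> (forall b, b \in y -> P b) ->
    (forall b c, P b -> P c -> P (b + c)) ->
    (forall b c, P b -> P c -> P (b * c)) ->
    forall b, P b.

Definition is_localization (B R : comPzRingType) (f : {rmorphism B -> R})
    (S : set B) : Prop :=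
  (S 1 /\ forall s t, S s -> S t -> S (s * t)) /\
  [/\ forall s, S s -> exists v, f s * v = 1,
      forall r, exists b s, S s /\ r * f s = f b
    & forall b, f b = 0 -> exists2 s, S s & s * b = 0].

Definition essentially_finite_type (R : comPzRingType)
    (iR : {rmorphism k -> R}) : Prop :=
  exists (B : comPzRingType) (iB : {rmorphism k -> B})
         (f : {rmorphism B -> R}) (S : set B),
    [/\ forall a, f (iB a) = iR a, finite_type iB & is_localization f S].

End FiniteType.

(* The tensor product of two [k]-algebras: formal sums of pairs, modulo
   equality of their values under every [k]-balanced biadditive map. *)
Section Tensor.
Context {k : fieldType} {A B : comPzRingType}.
Variables (iA : {rmorphism k -> A}) (iB : {rmorphism k -> B}).

Definition balanced (V : zmodType) (h : A -> B -> V) : Prop :=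
  [/\ forall x x' y, h (x + x') y = h x y + h x' y,
      forall x y y', h x (y + y') = h x y + h x y'
    & forall a x y, h (iA a * x) y = h x (iB a * y)].

Definition feval (V : zmodType) (h : A -> B -> V) (s : seq (A * B)) : V :=
  \sum_(u <- s) h u.1 u.2.

Definition tens_rel (s t : seq (A * B)) : bool :=
  `[< forall (V : zmodType) (h : A -> B -> V),
        balanced h -> feval h s = feval h t >].

Lemma tens_relP s t :
  reflect (forall (V : zmodType) (h : A -> B -> V),
             balanced h -> feval h s = feval h t) (tens_rel s t).
Proof. exact: asboolP. Qed.

Lemma tens_rel_refl : reflexive tens_rel.
Proof. by move=> s; apply/tens_relP. Qed.

Lemma tens_rel_sym : symmetric tens_rel.
Proof.
by move=> s t; apply/tens_relP/tens_relP => st V h bh; rewrite st.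
Qed.

Lemma tens_rel_trans : transitive tens_rel.
Proof.
move=> t s u /tens_relP st /tens_relP tu; apply/tens_relP => V h bh.
by rewrite st ?tu.
Qed.

Canonical tens_equiv := EquivRel tens_rel tens_rel_refl tens_rel_sym tens_rel_trans.

Definition tensor := {eq_quot tens_rel}.
HB.instance Definition _ := Choice.on tensor.
HB.instance Definition _ := EqQuotient.on tensor.

Lemma eq_tensor s t : reflect
  (forall (V : zmodType) (h : A -> B -> V), balanced h -> feval h s = feval h t)
  (\pi_tensor s == \pi_tensor t).
Proof. by rewrite piE; apply: tens_relP. Qed.

Lemma tensW (P : tensor -> Prop) :
  (forall s, P (\pi_tensor s)) -> forall w, P w.
Proof. by move=> Ps w; rewrite -[w]reprK; apply: Ps. Qed.

Definition tens (x : A) (y : B) : tensor := \pi_tensor [:: (x, y)].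

(* The additive map out of the tensor product induced by [h]; meaningful for
   balanced [h]. *)
Definition tens_lift (V : zmodType) (h : A -> B -> V) (w : tensor) : V :=
  feval h (repr w).

Lemma tens_lift_pi (V : zmodType) (h : A -> B -> V) s :
  balanced h -> tens_lift h (\pi_tensor s) = feval h s.
Proof.
by move=> bh; have /eqP/eq_tensor := reprK (\pi_tensor s); apply.
Qed.

Lemma feval_cat (V : zmodType) (h : A -> B -> V) s t : feval h (s ++ t) = feval h s + feval h t.
Proof. exact: big_cat. Qed.

Lemma balanced0l (V : zmodType) (h : A -> B -> V) y : balanced h -> h 0 y = 0.
Proof. by case=> hD _ _; apply: (addrI (h 0 y)); rewrite -hD !addr0. Qed.

Lemma balancedNl (V : zmodType) (h : A -> B -> V) x y : balanced h -> h (- x) y = - h x y.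
Proof.
move=> bh; case: (bh) => hD _ _; apply: (addrI (h x y)).
by rewrite -hD !subrr balanced0l.
Qed.

Definition fopp (s : seq (A * B)) := [seq (- u.1, u.2) | u <- s].
Definition fmul (s t : seq (A * B)) :=
  [seq (u.1 * v.1, u.2 * v.2) | u <- s, v <- t].

Lemma feval_opp (V : zmodType) (h : A -> B -> V) s : balanced h -> feval h (fopp s) = - feval h s.
Proof.
move=> bh; rewrite /feval big_map -sumrN; apply: eq_bigr => u _ /=.
exact: balancedNl.
Qed.

Lemma feval_mul (V : zmodType) (h : A -> B -> V) s t :
  feval h (fmul s t) = feval (fun x y => feval (fun x' y' => h (x * x') (y * y')) t) s.
Proof. exact: big_allpairs_dep. Qed.

Lemma feval_mulC (V : zmodType) (h : A -> B -> V) s t : feval h (fmul s t) = feval h (fmul t s).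
Proof.
rewrite !feval_mul /feval exchange_big; apply: eq_bigr => u _.
by apply: eq_bigr => v _; rewrite mulrC [u.2 * _]mulrC.
Qed.

Lemma balanced_mul (V : zmodType) (h : A -> B -> V) t : balanced h ->
  balanced (fun x y => feval (fun x' y' => h (x * x') (y * y')) t).
Proof.
case=> hDl hDr hB; split=> [x x' y|x y y'|a x y]; rewrite /feval -?big_split /=;
  by apply: eq_bigr => u _; rewrite ?mulrDl ?hDl ?hDr // -!mulrA hB.
Qed.

Definition tens_add (v w : tensor) : tensor := \pi_tensor (repr v ++ repr w).
Definition tens_opp (v : tensor) : tensor := \pi_tensor (fopp (repr v)).
Definition tens_mul (v w : tensor) : tensor := \pi_tensor (fmul (repr v) (repr w)).

Lemma feval_repr (V : zmodType) (h : A -> B -> V) s :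
  balanced h -> feval h (repr (\pi_tensor s)) = feval h s.
Proof. exact: tens_lift_pi. Qed.

Lemma pi_add s t : tens_add (\pi_tensor s) (\pi_tensor t) = \pi_tensor (s ++ t).
Proof. by apply/eqP/eq_tensor => V h bh; rewrite !feval_cat !feval_repr. Qed.

Lemma pi_opp s : tens_opp (\pi_tensor s) = \pi_tensor (fopp s).
Proof. by apply/eqP/eq_tensor => V h bh; rewrite !feval_opp ?feval_repr. Qed.

Lemma pi_mul s t : tens_mul (\pi_tensor s) (\pi_tensor t) = \pi_tensor (fmul s t).
Proof.
apply/eqP/eq_tensor => V h bh; rewrite feval_mul feval_repr; last exact: balanced_mul.
rewrite -feval_mul feval_mulC feval_mul feval_repr; last exact: balanced_mul.
by rewrite -feval_mul feval_mulC.
Qed.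

Lemma tens_addA : associative tens_add.
Proof.
by elim/tensW=> s; elim/tensW=> t; elim/tensW=> u; rewrite !pi_add catA.
Qed.

Lemma tens_addC : commutative tens_add.
Proof.
elim/tensW=> s; elim/tensW=> t; rewrite !pi_add.
by apply/eqP/eq_tensor => V h bh; rewrite !feval_cat addrC.
Qed.

Lemma tens_add0 : left_id (\pi_tensor [::]) tens_add.
Proof. by elim/tensW=> s; rewrite pi_add. Qed.

Lemma tens_addN : left_inverse (\pi_tensor [::]) tens_opp tens_add.
Proof.
elim/tensW=> s; rewrite pi_opp pi_add; apply/eqP/eq_tensor => V h bh.
by rewrite feval_cat feval_opp // addNr /feval big_nil.
Qed.

HB.instance Definition _ :=
  GRing.isZmodule.Build tensor tens_addA tens_addC tens_add0 tens_addN.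

Lemma tens_mulA : associative tens_mul.
Proof.
elim/tensW=> s; elim/tensW=> t; elim/tensW=> u; rewrite !pi_mul.
apply/eqP/eq_tensor => V h bh; rewrite !feval_mul; apply: eq_bigr => x _.
rewrite [LHS]feval_mul; apply: eq_bigr => y _; apply: eq_bigr => z _ /=.
by rewrite !mulrA.
Qed.

Lemma tens_mulC : commutative tens_mul.
Proof.
elim/tensW=> s; elim/tensW=> t; rewrite !pi_mul.
by apply/eqP/eq_tensor => V h bh; rewrite feval_mulC.
Qed.

Lemma tens_mul1 : left_id (tens 1 1) tens_mul.
Proof.
elim/tensW=> s; rewrite pi_mul; apply/eqP/eq_tensor => V h bh.
by rewrite feval_mul /feval big_seq1; apply: eq_bigr => u _; rewrite !mul1r.
Qed.

Lemma tens_mulDl : left_distributive tens_mul tens_add.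
Proof.
elim/tensW=> s; elim/tensW=> t; elim/tensW=> u; rewrite !(pi_add, pi_mul).
by apply/eqP/eq_tensor => V h bh; rewrite feval_cat !feval_mul feval_cat.
Qed.

HB.instance Definition _ :=
  GRing.Zmodule_isComPzRing.Build tensor tens_mulA tens_mulC tens_mul1 tens_mulDl.

Lemma tens_balanced : balanced tens.
Proof.
split=> [x x' y|x y y'|a x y].
- by apply/eqP; rewrite [X in _ == X]pi_add; apply/eq_tensor => V h [hD _ _];
    rewrite /feval big_seq1 big_cons big_seq1 hD.
- by apply/eqP; rewrite [X in _ == X]pi_add; apply/eq_tensor => V h [_ hD _];
    rewrite /feval big_seq1 big_cons big_seq1 hD.
by apply/eqP/eq_tensor => V h [_ _ hB]; rewrite /feval !big_seq1 hB.
Qed.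

Lemma tens_mulE x y x' y' : tens x y * tens x' y' = tens (x * x') (y * y').
Proof. by rewrite [LHS]pi_mul. Qed.

Lemma tens_sum (w : tensor) : exists s : seq (A * B), w = \sum_(u <- s) tens u.1 u.2.
Proof.
elim/tensW: w => s; exists s; elim: s => [|[x y] s IH]; first by rewrite big_nil.
by rewrite big_cons /= -IH [RHS]pi_add.
Qed.

(* Together with [tens_sum], the universal property of the tensor product. *)
Lemma tens_liftE (V : zmodType) (h : A -> B -> V) x y :
  balanced h -> tens_lift h (tens x y) = h x y.
Proof. by move=> bh; rewrite tens_lift_pi // /feval big_seq1. Qed.

Lemma tens_liftD (V : zmodType) (h : A -> B -> V) : balanced h ->
  {morph tens_lift h : v w / v + w}.
Proof.
move=> bh; elim/tensW=> s; elim/tensW=> t.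
by rewrite [_ + _]pi_add !tens_lift_pi // feval_cat.
Qed.

End Tensor.

Section TensorSquare.
Context {k : fieldType} {R : comPzRingType}.
Variable iR : {rmorphism k -> R}.

Lemma mul_balanced : balanced iR iR (fun x y : R => x * y).
Proof. by split=> *; rewrite ?mulrDl ?mulrDr // mulrCA mulrA. Qed.

Definition tens_mu : tensor iR iR -> R := tens_lift (fun x y : R => x * y).

Lemma tens_muE x y : tens_mu (tens iR iR x y) = x * y.
Proof. exact: (tens_liftE _ _ mul_balanced). Qed.

Lemma tens_muD : {morph tens_mu : v w / v + w}.
Proof. exact: tens_liftD mul_balanced. Qed.

Lemma tens_muM : {morph tens_mu : v w / v * w}.
Proof.
apply: tensW => s; apply: tensW => t; rewrite [X in tens_mu X]pi_mul /tens_mu.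
rewrite !tens_lift_pi; try exact: mul_balanced.
rewrite feval_mul mulr_suml; apply: eq_bigr => u _.
by rewrite mulr_sumr; apply: eq_bigr => v _; rewrite mulrACA.
Qed.

End TensorSquare.

(* Homomorphisms of [A]-modules from F^e_* A to A, as functions on [A]. *)
Definition frob_hom (p : nat) (A : comPzRingType) (e : nat) : set (A -> A) :=
  [set phi | (forall x y, phi (x + y) = phi x + phi y) /\
             (forall r x, phi (r ^+ (p ^ e) * x) = r * phi x)].

Record cartier_algebra (p : nat) (R : comPzRingType) := CartierAlgebra {
  cart_deg :> nat -> set (R -> R);
  cart_hom : forall e, cart_deg e `<=` frob_hom p e;
  cart_deg0 : cart_deg 0 = [set phi | exists r, phi = (fun x => r * x)];
  cart_0 : forall e, cart_deg e (fun=> 0);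
  cart_add : forall e phi psi, cart_deg e phi -> cart_deg e psi ->
    cart_deg e (fun x => phi x + psi x);
  cart_mull : forall e r phi, cart_deg e phi -> cart_deg e (fun x => r * phi x);
  cart_mulr : forall e r phi, cart_deg e phi -> cart_deg e (fun x => phi (r * x));
  cart_comp : forall e d phi psi, cart_deg e phi -> cart_deg d psi ->
    cart_deg (e + d) (fun x => phi (psi x)) }.

Section FrobHom.
Variables (p : nat) (A : comPzRingType).

Lemma frob_hom0P : @frob_hom p A 0 = [set phi | exists r, phi = (fun x => r * x)].
Proof.
apply/seteqP; split=> phi /=.
  move=> [_ phiM]; exists (phi 1); apply/funext => x.
  by rewrite mulrC -phiM expn0 expr1 mulr1.
by move=> [r ->]; split=> *; rewrite ?mulrDr // expn0 expr1 mulrCA.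
Qed.

Lemma frob_hom_0 e : @frob_hom p A e (fun=> 0).
Proof. by split=> *; rewrite ?addr0 ?mulr0. Qed.

Lemma frob_hom_add e (phi psi : A -> A) : frob_hom p e phi -> frob_hom p e psi ->
  frob_hom p e (fun x => phi x + psi x).
Proof.
by move=> [fD fM] [gD gM]; split=> *; rewrite ?fD ?gD 1?addrACA // fM gM mulrDr.
Qed.

Lemma frob_hom_mull e r (phi : A -> A) : frob_hom p e phi ->
  frob_hom p e (fun x => r * phi x).
Proof. by move=> [fD fM]; split=> *; rewrite ?fD ?mulrDr // fM mulrCA. Qed.

Lemma frob_hom_mulr e r (phi : A -> A) : frob_hom p e phi ->
  frob_hom p e (fun x => phi (r * x)).
Proof. by move=> [fD fM]; split=> *; rewrite ?mulrDr ?fD // mulrCA fM. Qed.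

Lemma frob_hom_comp e d (phi psi : A -> A) : frob_hom p e phi -> frob_hom p d psi ->
  frob_hom p (e + d) (fun x => phi (psi x)).
Proof.
move=> [fD fM] [gD gM]; split=> [x y|r x]; first by rewrite gD fD.
by rewrite expnD exprM gM fM.
Qed.

Definition full_cartier : cartier_algebra p A :=
  CartierAlgebra (fun e => @subset_refl _ _) frob_hom0P frob_hom_0
    frob_hom_add frob_hom_mull frob_hom_mulr frob_hom_comp.

End FrobHom.

Section DiagonalCartier.
Context {k : fieldType} {R : comPzRingType}.
Variables (p : nat) (iR : {rmorphism k -> R}).

Definition diag2 (e : nat) : set (R -> R) :=
  [set phi | frob_hom p e phi /\
     exists phi2 : tensor iR iR -> tensor iR iR,
       frob_hom p e phi2 /\ forall w, tens_mu (phi2 w) = phi (tens_mu w)].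

Lemma diag2_hom e : diag2 e `<=` frob_hom p e.
Proof. by move=> phi []. Qed.

Lemma diag2_deg0 : diag2 0 = [set phi | exists r, phi = (fun x => r * x)].
Proof.
apply/seteqP; split=> phi /=; first by move=> [+ _]; rewrite frob_hom0P.
move=> [r ->]; split; first by rewrite frob_hom0P; exists r.
exists (fun w => tens iR iR r 1 * w); split; first by rewrite frob_hom0P; exists (tens iR iR r 1).
by move=> w; rewrite tens_muM tens_muE mulr1.
Qed.

Lemma diag2_0 e : diag2 e (fun=> 0).
Proof.
split; first exact: frob_hom_0.
exists (fun=> 0); split; first exact: frob_hom_0.
by move=> _ /=; apply: (addrI (tens_mu (0 : tensor iR iR))); rewrite -tens_muD !addr0.
Qed.

Lemma diag2_add e phi psi : diag2 e phi -> diag2 e psi ->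
  diag2 e (fun x => phi x + psi x).
Proof.
move=> [f [f2 [hf2 ff]]] [g [g2 [hg2 gg]]]; split; first exact: frob_hom_add.
exists (fun w => f2 w + g2 w); split; first exact: frob_hom_add.
by move=> w; rewrite tens_muD ff gg.
Qed.

Lemma diag2_mull e r phi : diag2 e phi -> diag2 e (fun x => r * phi x).
Proof.
move=> [f [f2 [hf2 ff]]]; split; first exact: frob_hom_mull.
exists (fun w => tens iR iR r 1 * f2 w); split; first exact: frob_hom_mull.
by move=> w; rewrite tens_muM tens_muE mulr1 ff.
Qed.

Lemma diag2_mulr e r phi : diag2 e phi -> diag2 e (fun x => phi (r * x)).
Proof.
move=> [f [f2 [hf2 ff]]]; split; first exact: frob_hom_mulr.
exists (fun w => f2 (tens iR iR r 1 * w)); split; first exact: frob_hom_mulr.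
by move=> w; rewrite ff tens_muM tens_muE mulr1.
Qed.

Lemma diag2_comp e d phi psi : diag2 e phi -> diag2 d psi ->
  diag2 (e + d) (fun x => phi (psi x)).
Proof.
move=> [f [f2 [hf2 ff]]] [g [g2 [hg2 gg]]]; split; first exact: frob_hom_comp.
exists (fun w => f2 (g2 w)); split; first exact: frob_hom_comp.
by move=> w; rewrite ff gg.
Qed.

Definition diag2_cartier : cartier_algebra p R :=
  CartierAlgebra diag2_hom diag2_deg0 diag2_0 diag2_add diag2_mull diag2_mulr
    diag2_comp.

End DiagonalCartier.

Section TestIdeal.
Context {Re : realType} {p : nat} {R : comPzRingType}.

(* A formal product of real powers of ideals is the list of pairs (ideal,
   exponent). The absolute value only converts the ceiling, which is
   nonnegative for nonnegative exponents, to a natural number. *)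
Definition ideal_prod (e : nat) (aa : seq (set R * Re)) : set R :=
  \big[ideal_mul/setT]_(a <- aa)
    ideal_exp a.1 `|Num.ceil (a.2 * ((p ^ e)%:R - 1))|%N.

Definition compatible (C : cartier_algebra p R) (aa : seq (set R * Re))
    (J : set R) : Prop :=
  forall e phi x y, C e phi -> ideal_prod e aa x -> J y -> J (phi (x * y)).

Definition is_test_ideal (C : cartier_algebra p R) (aa : seq (set R * Re))
    (J : set R) : Prop :=
  [/\ is_ideal J, has_regular J, compatible C aa J &
      forall J', is_ideal J' -> has_regular J' -> compatible C aa J' -> J `<=` J'].

Lemma test_ideal_unique C aa J J' :
  is_test_ideal C aa J -> is_test_ideal C aa J' -> J = J'.
Proof.
by move=> [? ? ? Jmin] [? ? ? J'min]; apply/seteqP; split; [apply: Jmin|apply: J'min].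
Qed.

End TestIdeal.

(* Main.v *)
Require Import Defs.
From mathcomp Require Import all_boot all_order all_algebra.
From mathcomp Require Import boolp classical_sets reals.

Set Implicit Arguments.
Unset Strict Implicit.
Unset Printing Implicit Defensive.

Import GRing.Theory.
Local Open Scope classical_set_scope.
Local Open Scope ring_scope.

(** The product [tau_a * tau_b] is an ideal with a regular element, so by
minimality of [tauD] it is enough to show that it is compatible with
[diag2_cartier]. Take [phi] of degree [e] with a lift [phi2] to [R (x) R], and
[x1 * x2] in the product of the powers of [a] and [b], [y1] in [tau_a], [y2] in
[tau_b]. Since [phi (x1 * y1 * (x2 * y2))] is the image under multiplication of
[w := phi2 (x1 * y1 (x) x2 * y2)], it suffices that [w] is a sum of tensors
[u (x) v] with [u] in [tau_a] and [v] in [tau_b].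

The usual argument decomposes [phi2] as a sum of tensors of maps
[F^e_* R -> R]. Slicing gives a shorter route. For a [k]-linear form [l] on
[R] and a fixed [v], the map [x |-> (id (x) l) (phi2 (x (x) v))] is again a
homomorphism [F^e_* R -> R] (frob_hom_slice_l), because [phi2] is semilinear in
each tensor factor separately. Compatibility of [tau_a] with all such
homomorphisms puts every slice [(id (x) l) w] in [tau_a], and symmetrically
every slice [(l (x) id) w] is in [tau_b].

It remains to see that a tensor whose slices lie in [I] on the left and in [J]
on the right is a sum of tensors of elements of [I] and [J] (tensor_of_slices);
this is where the base being a field matters. In an expression of [w] as a sum
of the least possible number of tensors [x_i (x) y_i], both the [x_i] and the
[y_i] are linearly independent, hence admit dual linear forms, and slicing by
these shows that each [x_i] and each [y_i] is itself a slice of [w]. *)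

(** * Linear forms on an algebra over a field *)

Section LinearForms.
Context {k : fieldType} {B : comPzRingType}.
Variable iB : {rmorphism k -> B}.

Definition subspace (S : set B) : Prop :=
  [/\ S 0, forall x y, S x -> S y -> S (x + y)
    & forall c x, S x -> S (iB c * x)].

Definition linear_form (l : B -> k) : Prop :=
  (forall x y, l (x + y) = l x + l y) /\ (forall c x, l (iB c * x) = c * l x).

Lemma subspaceB S x y : subspace S -> S x -> S y -> S (x - y).
Proof.
move=> [_ SD SZ] Sx Sy; apply: SD => //.
by have := SZ (-1) _ Sy; rewrite rmorphN1 mulN1r.
Qed.

(** Zorn's lemma applies because both conditions pass to unions of chains. *)
Lemma maximal_subspace_avoiding (S : set B) y : subspace S -> ~ S y ->
  exists T, [/\ subspace T, S `<=` T, ~ T y &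
    forall T', subspace T' -> T `<=` T' -> ~ T' y -> T' `<=` T].
Proof.
move=> subS Sy.
(* The empty chain is admissible because [S] is joined to each member. *)
pose P (W : set B) := subspace (S `|` W) /\ ~ (S `|` W) y.
have [F FP Ftot|W [[subW Wy] Wmax]] := @Zorn_bigcup B P; last first.
  exists (S `|` W); split=> //.
  move=> T' subT' WT' T'y.
  have ST' : S `|` T' = T' by apply/setUidr => x Sx; apply: WT'; left.
  apply: contrapT => T'W; apply: (Wmax T') => //; rewrite ?/P ?ST' //.
  split=> [x Wx|T'sub]; first by apply: WT'; right.
  by apply: T'W => x /T'sub; right.
split; last first.
  by move=> [//|[X FX Xy]]; case: (FP X FX) => _; apply; right.
have [S0 SD SZ] := subS.
split=> [|x z|c x]; first by left.
- have common X x' z' : F X -> (S `|` X) x' -> (S `|` X) z' ->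
      (S `|` \bigcup_(X in F) X) (x' + z').
    move=> FX Xx Xz; have [[_ XD _] _] := FP X FX.
    by have [|XD'] := XD _ _ Xx Xz; [left|right; exists X].
  move=> [Sx|[X FX Xx]] [Sz|[Z FZ Zz]].
  + by left; apply: SD.
  + by apply: (common Z) => //; [left|right].
  + by apply: (common X) => //; [right|left].
  + have [XZ|ZX] := Ftot _ _ FX FZ.
      by apply: (common Z) => //; right=> //; apply: XZ.
    by apply: (common X) => //; right=> //; apply: ZX.
- move=> [Sx|[X FX Xx]]; first by left; apply: SZ.
  have [[_ _ XZ] _] := FP X FX.
  by have [|] := XZ c x (or_intror Xx); [left|right; exists X].
Qed.

(** A maximal subspace avoiding [y] is a complement of the line through [y], and
the form is the coordinate along that line. *)
Lemma separating_form (S : set B) y : subspace S -> ~ S y ->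
  exists l, [/\ linear_form l, l y = 1 & forall x, S x -> l x = 0].
Proof.
move=> subS Sy; have [T [subT ST Ty Tmax]] := maximal_subspace_avoiding subS Sy.
have [T0 TD TZ] := subT.
have coord v : exists c, T (v - iB c * y).
  have [Tv|Tv] := pselect (T v); first by exists 0; rewrite rmorph0 mul0r subr0.
  pose T' := [set x | exists c, T (x - iB c * v)].
  have subT' : subspace T'.
    split; first by exists 0; rewrite rmorph0 mul0r subr0.
      move=> x z [c Tx] [d Tz]; exists (c + d).
      by rewrite rmorphD mulrDl opprD addrACA; apply: TD.
    move=> d x [c Tx]; exists (d * c).
    by rewrite rmorphM -mulrA -mulrBr; apply: TZ.
  have TT' : T `<=` T' by move=> x Tx; exists 0; rewrite rmorph0 mul0r subr0.
  have T'v : T' v by exists 1; rewrite rmorph1 mul1r subrr.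
  have [c Tc] : T' y.
    by apply: contrapT => T'y; apply: Tv; apply: (Tmax T') T'v.
  have c0 : c != 0.
    by apply: contra_notN Ty => /eqP c0; rewrite c0 rmorph0 mul0r subr0 in Tc.
  exists c^-1; have := TZ (- c^-1) _ Tc.
  by rewrite rmorphN mulNr mulrBr mulrA -rmorphM mulVf // rmorph1 mul1r opprB.
have coord_uniq v c d : T (v - iB c * y) -> T (v - iB d * y) -> c = d.
  move=> Tc Td; apply/eqP; rewrite -subr_eq0; apply: contra_notT Ty => cd.
  have := TZ (c - d)^-1 _ (subspaceB subT Td Tc).
  rewrite opprB [_ + (_ - v)]addrC addrA subrK -mulrBl -rmorphB mulrA -rmorphM.
  by rewrite mulVf // rmorph1 mul1r.
have [l lP] := choice coord.
exists l; split; last 1 first.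
- move=> x Sx; apply: (coord_uniq x) => //.
  by rewrite rmorph0 mul0r subr0; apply: ST.
- split=> [x z|c x].
    apply: (coord_uniq (x + z)) => //.
    by rewrite rmorphD mulrDl opprD addrACA; apply: TD.
  apply: (coord_uniq (iB c * x)) => //.
  by rewrite rmorphM -mulrA -mulrBr; apply: TZ.
by apply: (coord_uniq y) => //; rewrite rmorph1 mul1r subrr.
Qed.

End LinearForms.

(** * Shortest expressions as sums of tensors *)

Section ShortestSum.
Context {k : fieldType} {A B : comPzRingType}.
Variables (iA : {rmorphism k -> A}) (iB : {rmorphism k -> B}).

Definition sum_of_terms (V : zmodType) (h : A -> B -> V) (w : V) (n : nat) : Prop :=
  exists (x : 'I_n -> A) (y : 'I_n -> B), w = \sum_i h (x i) (y i).

(** A linear relation expressing [y i] through the other [y j] distributes the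
[i]-th term over the others. *)
Lemma sum_of_terms_shorten (V : zmodType) (h : A -> B -> V) n
    (x : 'I_n.+1 -> A) (y : 'I_n.+1 -> B) i (c : 'I_n -> k) :
  balanced iA iB h -> y i = \sum_j iB (c j) * y (lift i j) ->
  sum_of_terms h (\sum_j h (x j) (y j)) n.
Proof.
move=> bh yi; have [hDl hDr hB] := bh.
exists (fun j => x (lift i j) + iA (c j) * x i), (fun j => y (lift i j)).
rewrite (bigD1_ord i) //= yi.
have h0 z : h z 0 = 0 by apply: (addrI (h z 0)); rewrite -hDr !addr0.
have -> : h (x i) (\sum_j iB (c j) * y (lift i j))
    = \sum_j h (x i) (iB (c j) * y (lift i j)).
  by apply: (big_morph (h (x i))).
by rewrite addrC -big_split; apply: eq_bigr => j _; rewrite /= hDl hB.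
Qed.

(** In a shortest expression no [y i] is a combination of the others, so a form
separating it from their span is the dual one. *)
Lemma dual_form (V : zmodType) (h : A -> B -> V) n
    (x : 'I_n.+1 -> A) (y : 'I_n.+1 -> B) i :
  balanced iA iB h -> ~ sum_of_terms h (\sum_j h (x j) (y j)) n ->
  exists2 l, linear_form iB l & forall j, l (y j) = (j == i)%:R.
Proof.
move=> bh short.
pose S := [set z | exists c : 'I_n -> k, z = \sum_j iB (c j) * y (lift i j)].
have subS : subspace iB S.
  split.
  - by exists (fun=> 0); rewrite big1 // => j _; rewrite rmorph0 mul0r.
  - move=> _ _ [c ->] [d ->]; exists (fun j => c j + d j).
    by rewrite -big_split; apply: eq_bigr => j _; rewrite /= rmorphD mulrDl.
  - move=> d _ [c ->]; exists (fun j => d * c j).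
    by rewrite mulr_sumr; apply: eq_bigr => j _; rewrite rmorphM mulrA.
have Sy : ~ S (y i) by move=> [c yi]; apply: short; apply: sum_of_terms_shorten yi.
have [l [lin ly lS]] := separating_form subS Sy.
exists l => // j; case: (unliftP i j) => [j' ->|->]; last by rewrite eqxx.
rewrite eq_sym (negPf (neq_lift _ _)); apply: lS.
exists (fun m => (m == j')%:R); rewrite (bigD1 j') //= eqxx rmorph1 mul1r.
rewrite big1 ?addr0 // => m /negPf ->.
by rewrite rmorph0 mul0r.
Qed.

End ShortestSum.

(** * Slices of tensors *)

Section Slices.
Context {k : fieldType} {A B : comPzRingType}.
Variables (iA : {rmorphism k -> A}) (iB : {rmorphism k -> B}).

Local Notation tensor := (tensor iA iB).
Local Notation tens := (tens iA iB).

(** [id (x) l] and [l (x) id], followed by [A (x) k = A] and [k (x) B = B]. *)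
Definition slice_l (l : B -> k) : tensor -> A :=
  tens_lift (fun x y => iA (l y) * x).

Definition slice_r (l : A -> k) : tensor -> B :=
  tens_lift (fun x y => iB (l x) * y).

Lemma slice_l_balanced l : linear_form iB l ->
  balanced iA iB (fun x y => iA (l y) * x).
Proof.
move=> [lD lZ]; split=> *; first by rewrite mulrDr.
  by rewrite lD rmorphD mulrDl.
by rewrite lZ rmorphM mulrCA mulrA.
Qed.

Lemma slice_r_balanced l : linear_form iA l ->
  balanced iA iB (fun x y => iB (l x) * y).
Proof.
move=> [lD lZ]; split=> *; last by rewrite lZ rmorphM mulrCA mulrA.
  by rewrite lD rmorphD mulrDl.
by rewrite mulrDr.
Qed.

Lemma tens_lift_sum (V : zmodType) (h : A -> B -> V) (T : Type) (r : seq T)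
    (x : T -> A) (y : T -> B) :
  balanced iA iB h ->
  tens_lift h (\sum_(i <- r) tens (x i) (y i)) = \sum_(i <- r) h (x i) (y i).
Proof.
move=> bh; have hD := tens_liftD bh.
have h0 : tens_lift h (0 : tensor) = 0.
  by apply: (addrI (tens_lift h (0 : tensor))); rewrite -hD !addr0.
by rewrite (big_morph _ hD h0); apply: eq_bigr => i _; rewrite tens_liftE.
Qed.

Lemma slice_lZ l r w : linear_form iB l ->
  slice_l l (tens r 1 * w) = r * slice_l l w.
Proof.
move=> lin; have bh := slice_l_balanced lin; have [s ->] := tens_sum w.
rewrite mulr_sumr; under eq_bigr do rewrite tens_mulE.
rewrite /slice_l !tens_lift_sum // mulr_sumr.
by apply: eq_bigr => u _; rewrite mul1r mulrCA.
Qed.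

Lemma slice_rZ l r w : linear_form iA l ->
  slice_r l (tens 1 r * w) = r * slice_r l w.
Proof.
move=> lin; have bh := slice_r_balanced lin; have [s ->] := tens_sum w.
rewrite mulr_sumr; under eq_bigr do rewrite tens_mulE.
rewrite /slice_r !tens_lift_sum // mulr_sumr.
by apply: eq_bigr => u _; rewrite mul1r mulrCA.
Qed.

(** In a shortest expression of [w], the entries of the terms are themselves
slices of [w], by the dual forms. *)
Lemma tensor_of_slices (I : set A) (J : set B) (w : tensor) :
  (forall l, linear_form iB l -> I (slice_l l w)) ->
  (forall l, linear_form iA l -> J (slice_r l w)) ->
  exists n (x : 'I_n -> A) (y : 'I_n -> B),
    [/\ w = \sum_i tens (x i) (y i), forall i, I (x i) & forall i, J (y i)].
Proof.
move=> wI wJ.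
have ex_sum : exists m, (fun m => `[< sum_of_terms tens w m >]) m.
  have [s ->] := tens_sum w; exists (size s); apply/asboolP.
  exists (fun i => (tnth (in_tuple s) i).1), (fun i => (tnth (in_tuple s) i).2).
  by rewrite big_tnth.
have [n /asboolP [x [y def_w]] n_min] := ex_minnP ex_sum.
exists n, x, y; case: n => [|n] in x y def_w n_min *.
  by split=> // -[].
have short : ~ sum_of_terms tens w n.
  by move=> /asboolP/n_min; rewrite ltnn.
have pick (V : comPzRingType) (iV : {rmorphism k -> V}) (z : 'I_n.+1 -> V) i :
    \sum_j iV ((j == i)%:R) * z j = z i.
  rewrite (bigD1 i) //= eqxx rmorph1 mul1r big1 ?addr0 // => j /negPf ->.
  by rewrite rmorph0 mul0r.
split=> // i.
  have [|l lin ly] := dual_form (x := x) (y := y) i (tens_balanced iA iB).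
    by rewrite -def_w.
  have := wI l lin; rewrite def_w /slice_l tens_lift_sum.
    by under eq_bigr do rewrite ly; rewrite pick.
  exact: slice_l_balanced.
(* Forms dual to the [x i] come from exchanging the two factors. *)
have flip : balanced iB iA (fun b a => tens a b).
  by have [tDl tDr tB] := tens_balanced iA iB; split=> *; rewrite ?tDl ?tDr ?tB.
have [|l lin lx] := dual_form (x := y) (y := x) i flip.
  by rewrite -def_w => -[y' [x' def_w']]; apply: short; exists x', y'.
have := wJ l lin; rewrite def_w /slice_r tens_lift_sum.
  by under eq_bigr do rewrite lx; rewrite pick.
exact: slice_r_balanced.
Qed.

Lemma tensX x y n : tens x y ^+ n = tens (x ^+ n) (y ^+ n).
Proof.
elim: n => [|n IH]; first by rewrite !expr0.
by rewrite !exprS IH tens_mulE.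
Qed.

(** Multiplying the left factor by [r ^+ (p ^ e)] is multiplying by the power
[tens r 1 ^+ (p ^ e)], which [phi2] pulls out as [tens r 1]; slicing on the
right factor is linear over the left one. *)
Lemma frob_hom_slice_l p e (phi2 : tensor -> tensor) l v :
  frob_hom p e phi2 -> linear_form iB l ->
  frob_hom p e (fun x => slice_l l (phi2 (tens x v))).
Proof.
move=> [fD fM] lin; have [tD _ _] := tens_balanced iA iB.
split=> [x y|r x].
  by rewrite tD fD /slice_l (tens_liftD (slice_l_balanced lin)).
rewrite -slice_lZ // -fM; congr (slice_l l (phi2 _)).
by rewrite tensX tens_mulE expr1n mul1r.
Qed.

Lemma frob_hom_slice_r p e (phi2 : tensor -> tensor) l u :
  frob_hom p e phi2 -> linear_form iA l ->
  frob_hom p e (fun y => slice_r l (phi2 (tens u y))).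
Proof.
move=> [fD fM] lin; have [_ tD _] := tens_balanced iA iB.
split=> [x y|r x].
  by rewrite tD fD /slice_r (tens_liftD (slice_r_balanced lin)).
rewrite -slice_rZ // -fM; congr (slice_r l (phi2 _)).
by rewrite tensX tens_mulE expr1n mul1r.
Qed.

End Slices.

(** * Products of ideals *)

Section IdealMul.
Context {R : comPzRingType}.
Implicit Types I J : set R.

Lemma ideal_mul_mem I J x y : I x -> J y -> ideal_mul I J (x * y).
Proof.
move=> Ix Jy; exists [:: (x, y)]; last by rewrite big_seq1.
by move=> u; rewrite inE => /eqP ->.
Qed.

Lemma ideal_mul_ideal I J : is_ideal I -> is_ideal (ideal_mul I J).
Proof.
move=> [_ _ IM]; split; first by exists [::]; rewrite ?big_nil.
  move=> _ _ [s sP ->] [t tP ->]; exists (s ++ t); last by rewrite big_cat.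
  by move=> u; rewrite mem_cat => /orP[/sP|/tP].
move=> r _ [s sP ->]; exists [seq (r * u.1, u.2) | u <- s].
  by move=> _ /mapP[u /sP[Iu Ju] ->]; split=> //; apply: IM.
by rewrite big_map mulr_sumr; apply: eq_bigr => u _; rewrite mulrA.
Qed.

Lemma ideal_sum I (T : eqType) (s : seq T) (F : T -> R) :
  is_ideal I -> (forall u, u \in s -> I (F u)) -> I (\sum_(u <- s) F u).
Proof. by move=> [I0 ID _] IF; rewrite big_seq; apply: big_ind. Qed.

End IdealMul.

(** * Compatibility of a product of test ideals *)

Section Compatible.
Context {k : fieldType} {R : comPzRingType} {Re : realType}.
Variables (p : nat) (iR : {rmorphism k -> R}).
Implicit Types aa bb : seq (set R * Re).

(** The tensor [phi2 (x1 * y1 (x) x2 * y2)] has its slices in [I] and [J], being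
values of homomorphisms [F^e_* R -> R] at [x1 * y1] and [x2 * y2]. *)
Lemma diag2_mem_ideal_mul aa bb (I J : set R) e phi x1 x2 y1 y2 :
  is_ideal I ->
  compatible (full_cartier p R) aa I -> compatible (full_cartier p R) bb J ->
  diag2_cartier p iR e phi ->
  ideal_prod (p := p) e aa x1 -> ideal_prod (p := p) e bb x2 -> I y1 -> J y2 ->
  ideal_mul I J (phi (x1 * x2 * (y1 * y2))).
Proof.
move=> idI cI cJ [_ [phi2 [hom2 lift2]]] ax1 bx2 Iy1 Jy2.
have [||n [x [y [def_w Ix Jy]]]] :=
  tensor_of_slices (I := I) (J := J)
    (w := phi2 (tens iR iR (x1 * y1) (x2 * y2))).
- move=> l lin.
  exact: (cI e _ x1 y1 (frob_hom_slice_l (x2 * y2) hom2 lin)).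
- move=> l lin.
  exact: (cJ e _ x2 y2 (frob_hom_slice_r (x1 * y1) hom2 lin)).
rewrite mulrACA -(tens_muE iR) -lift2 def_w /tens_mu.
rewrite (tens_lift_sum _ _ _ (mul_balanced iR)).
apply: ideal_sum (ideal_mul_ideal _ idI) _ => i _.
exact: ideal_mul_mem.
Qed.

Lemma compatible_diag2_mul (a b : set R) (s t : Re) (I J : set R) :
  is_ideal I ->
  compatible (full_cartier p R) [:: (a, s)] I ->
  compatible (full_cartier p R) [:: (b, t)] J ->
  compatible (diag2_cartier p iR) [:: (a, s); (b, t)] (ideal_mul I J).
Proof.
move=> idI cI cJ e phi x y Dphi.
rewrite /ideal_prod big_cons => -[sx sxP ->] [sy syP ->].
have [phiD _] := cart_hom Dphi.
have phi0 : phi 0 = 0 by apply: (addrI (phi 0)); rewrite -phiD !addr0.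
have idIJ := ideal_mul_ideal J idI.
rewrite mulr_suml (big_morph phi phiD phi0).
apply: ideal_sum => // u /sxP[au bu].
rewrite mulr_sumr (big_morph phi phiD phi0).
apply: ideal_sum => // v /syP[Iv Jv].
apply: diag2_mem_ideal_mul cI cJ Dphi _ bu Iv Jv => //.
(* A formal product with one entry is still multiplied by the unit ideal. *)
by rewrite /ideal_prod big_cons big_nil -[u.1]mulr1; apply: ideal_mul_mem.
Qed.

End Compatible.

Theorem theorem3p11 (p : nat) (k : fieldType) (kp : p \in [pchar k])
  (kperf : forall a : k, exists b : k, b ^+ p = a)
  (R : comPzRingType) (iR : {rmorphism k -> R})
  (Rred : reduced R) (Reft : essentially_finite_type iR)
  (Re : realType) (s t : Re) (s0 : 0 <= s) (t0 : 0 <= t)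
  (a b : set R) (ha : is_ideal a) (hb : is_ideal b)
  (ra : has_regular a) (rb : has_regular b)
  (tauD tau_a tau_b : set R)
  (hD : is_test_ideal (diag2_cartier p iR) [:: (a, s); (b, t)] tauD)
  (hta : is_test_ideal (full_cartier p R) [:: (a, s)] tau_a)
  (htb : is_test_ideal (full_cartier p R) [:: (b, t)] tau_b) :
  tauD `<=` ideal_mul tau_a tau_b.
Proof.
have [idA [ca tau_ca reg_ca] compA _] := hta.
have [_ [cb tau_cb reg_cb] compB _] := htb.
have [_ _ _ minD] := hD; apply: minD.
- exact: ideal_mul_ideal.
- by exists (ca * cb); [apply: ideal_mul_mem|apply: lregM].
- exact: compatible_diag2_mul.
Qed.
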